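(* Let $k>2$ and let $M$ be a hypersurface in $\mathbb C^2$ given by $v=x^k+G(x,u)$, where $G(x,u)=\sum_{j=0}^\infty X_j(u)x^j$ contains only terms of weight greater than $k$. Then there exists a (formal) transformation of the form $$z^*=z+\psi(w),\qquad w^*=w+\phi(w)$$ which takes $M$ into normal form, i.e. to a hypersurface $v^*=(x^* )^k+G^*(x^*,u^* )$ with $G^*(x^*,u^* )=\sum_{j=0}^\infty X^*_j(u^* )(x^* )^j$ containing only terms of weight greater than $k$ and $$X^*_0=X^*_{k-1}=X^*_k=X^*_{2k-1}=0 .$$
   Context: Coordinates in $\mathbb C^2$ are $(z,w)$ with $z=x+iy$, $w=u+iv$ (and similarly with stars). The variables $z,x,y$ have weight $1$ and $w,u$ have weight $k$. Power series ($G$ real, $\psi,\phi$ complex without constant terms) are allowed to be formal. The hypersurfaces considered are those admitting a nontransversal infinitesimal CR automorphism, which in suitable coordinates have the form $v=x^k+G(x,u)$ (independent of $y$). *)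

(* Defs.v *)
From HB Require Import structures.
From mathcomp Require Import all_boot all_order all_algebra.
From mathcomp Require Import boolp reals complex.

Set Implicit Arguments.
Unset Strict Implicit.
Unset Printing Implicit Defensive.

Import GRing.Theory.
Local Open Scope ring_scope.

(* [fps R] is R[[t]].  It is a record rather than an alias of [nat -> R], on
   which the libraries already put the pointwise ring structure. *)
Record fps (R : Type) := Fps { fps_coef :> nat -> R }.

HB.instance Definition _ (R : Type) := gen_eqMixin (fps R).
HB.instance Definition _ (R : Type) := gen_choiceMixin (fps R).

Lemma fpsP (R : Type) (f g : fps R) : (forall n, f n = g n) <-> f = g.
Proof.
split=> [|-> //]; case: f g => [f] [g] /= fg.
by congr Fps; apply/funext.
Qed.

Section FpsZmodule.
Variable R : zmodType.
Implicit Types f g h : fps R.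

Definition fps_zero : fps R := Fps (fun=> 0).
Definition fps_opp f : fps R := Fps (fun n => - f n).
Definition fps_add f g : fps R := Fps (fun n => f n + g n).

Let addA : associative fps_add.
Proof. by move=> f g h; apply/fpsP => n; apply: addrA. Qed.
Let addC : commutative fps_add.
Proof. by move=> f g; apply/fpsP => n; apply: addrC. Qed.
Let add0 : left_id fps_zero fps_add.
Proof. by move=> f; apply/fpsP => n; apply: add0r. Qed.
Let addN : left_inverse fps_zero fps_opp fps_add.
Proof. by move=> f; apply/fpsP => n; apply: addNr. Qed.

HB.instance Definition _ := GRing.isZmodule.Build (fps R) addA addC add0 addN.

Lemma coef_fps0 n : (0 : fps R) n = 0. Proof. by []. Qed.
Lemma coef_fpsN f n : (- f) n = - f n. Proof. by []. Qed.
Lemma coef_fpsD f g n : (f + g) n = f n + g n. Proof. by []. Qed.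

End FpsZmodule.

Section FpsRing.
Variable R : comNzRingType.
Implicit Types (f g h : fps R) (c : R).

Definition fpsC c : fps R := Fps (fun n => if n == 0%N then c else 0).
Definition fpsX : fps R := Fps (fun n => (n == 1%N)%:R).
Definition fps_mul f g : fps R :=
  Fps (fun n => \sum_(i < n.+1) f i * g (n - i)%N).

Let trunc N f : {poly R} := \poly_(i < N.+1) f i.

Let coef_trunc N f n : (n <= N)%N -> (trunc N f)`_n = f n.
Proof. by move=> le_nN; rewrite coef_poly ltnS le_nN. Qed.

Let mul_trunc N f g n :
  (n <= N)%N -> fps_mul f g n = (trunc N f * trunc N g)`_n.
Proof.
move=> le_nN; rewrite coefM; apply: eq_bigr => i _.
by rewrite !coef_trunc // (leq_trans _ le_nN) ?leq_subr // -ltnS.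
Qed.

Let mulC : commutative fps_mul.
Proof. by move=> f g; apply/fpsP=> n; rewrite !(mul_trunc _ _ (leqnn n)) mulrC. Qed.
Let mulA : associative fps_mul.
Proof.
move=> f g h; apply/fpsP => n.
transitivity ((trunc n f * trunc n g * trunc n h)`_n).
  rewrite -mulrA coefM; apply: eq_bigr => i _.
  by rewrite coef_trunc -1?ltnS // (mul_trunc _ _ (leq_subr i n)).
rewrite coefM; apply: eq_bigr => i _.
by rewrite coef_trunc ?leq_subr // (mul_trunc (N := n)) // -ltnS.
Qed.
Let mul1 : left_id (fpsC 1) fps_mul.
Proof.
move=> f; apply/fpsP => n /=; rewrite big_ord_recl /= subn0 mul1r.
by rewrite big1 ?addr0 // => i _; rewrite mul0r.
Qed.
Let mulDl : left_distributive fps_mul +%R.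
Proof.
move=> f g h; apply/fpsP => n /=; rewrite -big_split.
by apply: eq_bigr => i _; rewrite mulrDl.
Qed.
Let one_neq0 : fpsC 1 != 0.
Proof. by apply/eqP => /fpsP/(_ 0%N)/eqP; rewrite /= oner_eq0. Qed.

HB.instance Definition _ :=
  GRing.Zmodule_isComNzRing.Build (fps R) mulA mulC mul1 mulDl one_neq0.

Lemma coef_fps1 n : (1 : fps R) n = (n == 0%N)%:R.
Proof. by rewrite /=; case: eqP. Qed.
Lemma coef_fpsM f g n : (f * g) n = \sum_(i < n.+1) f i * g (n - i)%N.
Proof. by []. Qed.

End FpsRing.

Arguments fpsX {R}.

(* [ps2 R] is R[[u]][[x]]: for G : ps2 R, [G j] is the coefficient X_j(u) of
   x^j, and [G j m] that of x^j u^m. *)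
Notation ps2 R := (fps (fps R)).

Definition ps2X {R : comNzRingType} : ps2 R := fpsX.
Definition ps2U {R : comNzRingType} : ps2 R := fpsC fpsX.

Section Substitution.
Variable R : comNzRingType.

(* f(A) and F(A, B).  These are the usual substitutions only when A and B have
   zero constant term: then A^n (resp. A^j B^m) has order at least n (resp.
   j + m), so the terms dropped below do not contribute to x^a u^b. *)
Definition subst1 (f : fps R) (A : ps2 R) : ps2 R :=
  Fps (fun a => Fps (fun b =>
    \sum_(n < (a + b).+1) f n * (A ^+ n) a b)).

Definition subst2 (F A B : ps2 R) : ps2 R :=
  Fps (fun a => Fps (fun b =>
    \sum_(j < (a + b).+1) \sum_(m < (a + b).+1)
      F j m * (A ^+ j * B ^+ m) a b)).

End Substitution.

Section Hypersurfaces.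
Variable R : realType.

Definition ps2_complex (A B : ps2 R) : ps2 R[i] :=
  Fps (fun a => Fps (fun b => Complex (A a b) (B a b))).
Definition ps2_Re (A : ps2 R[i]) : ps2 R :=
  Fps (fun a => Fps (fun b => complex.Re (A a b))).
Definition ps2_Im (A : ps2 R[i]) : ps2 R :=
  Fps (fun a => Fps (fun b => complex.Im (A a b))).

(* x has weight 1 and u has weight k. *)
Definition weight_gt (k : nat) (G : ps2 R) : Prop :=
  forall j m : nat, G j m != 0 -> (k < j + k * m)%N.

(* The formal point (z, w) lies on the hypersurface v = x^k + G(x, u). *)
Definition on_hypersurface (k : nat) (G : ps2 R) (z w : ps2 R[i]) : Prop :=
  ps2_Im w = ps2_Re z ^+ k + subst2 G (ps2_Re z) (ps2_Re w).

(* z* = z + psi(w), w* = w + phi(w) is a formal change of coordinates at the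
   origin; its Jacobian determinant there is 1 + phi'(0). *)
Definition formal_transformation (psi phi : fps R[i]) : Prop :=
  [/\ psi 0%N = 0, phi 0%N = 0 & 1 + phi 1%N != 0].

(* M = {v = x^k + G(x, u)} is parametrized by the formal variables x, u and by
   y.  The coordinate y occurs only in z = x + iy and is not substituted into
   any series, so instead of adjoining a third formal variable it is taken to
   be an arbitrary real series. *)
Definition takes_into (k : nat) (psi phi : fps R[i]) (G G' : ps2 R) : Prop :=
  forall y : ps2 R,
    let z := ps2_complex ps2X y in
    let w := ps2_complex ps2U (ps2X ^+ k + G) in
    on_hypersurface k G' (z + subst1 psi w) (w + subst1 phi w).

Definition normal_form (k : nat) (G : ps2 R) : Prop :=
  weight_gt k G /\
  [/\ G 0%N = 0, G k.-1 = 0, G k = 0 & G (2 * k).-1 = 0].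

End Hypersurfaces.

(* Main.v *)
Require Import Defs.
From mathcomp Require Import all_boot all_order all_algebra.
From mathcomp Require Import boolp reals complex.
From mathcomp Require Import ring zify.

Set Implicit Arguments.
Unset Strict Implicit.
Unset Printing Implicit Defensive.

Import Order.TTheory GRing.Theory Num.Theory.
Local Open Scope ring_scope.

(** Let [w = u + i (x^k + G)] be the coordinate [w] restricted to [M].  The
    image of [M] is [v = x^k + H(x, u)] exactly when the series
      [x^k + G + Im phi(w) - (x + Re psi(w))^k - H(x + Re psi(w), u + Re phi(w))],
    called the residual below, vanishes; [y] has disappeared from it.  This is
    one equation in [R[[x, u]]], and it is solved for [psi], [phi] and [H]
    together, so that the change of coordinates never has to be inverted.

    The equation is triangular for the weight.  Fix a weight [mu > k] and vary
    [phi_n] with [k n >= mu], [psi_n] with [k n + k - 1 >= mu] and the part of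
    [H] of weight at least [mu], by [dphi], [dpsi] and [dH].  Up to weight [mu]
    the residual changes only by
      [Im dphi(w) - k x^(k-1) Re dpsi(w) - dH]        ([residualB]),
    and in weight [mu] the series [w] may be replaced by [u + i x^k].  Reading off
    coefficients ([linear_part_0], [linear_part_k], [linear_part_k1],
    [linear_part_2k1]):
      [u^n] gives [Im dphi_n],            [x^k u^(n-1)] gives [n Re dphi_n],
      [x^(k-1) u^n] gives [- k Re dpsi_n], [x^(2k-1) u^(n-1)] gives [k n Im dpsi_n].
    These are precisely the four families of monomials excluded from a normal
    form, so each of them has its own real parameter in [psi] and [phi], while
    every other monomial has its own coefficient in [H].

    All parameters are therefore packed, suitably scaled, into a single real
    series [U], indexed by the monomial that each one controls.  Correcting [U]
    by the residual raises the weight up to which the equation holds, and the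
    limit of the iteration is a solution ([triangular_solution]). *)

(** * Coefficients *)

Lemma ps2P (R : Type) (A B : ps2 R) : (forall a b, A a b = B a b) -> A = B.
Proof. by move=> AB; apply/fpsP => a; apply/fpsP => b. Qed.

Section Coefficients.
Variable R : comNzRingType.
Implicit Types (c : R) (f : fps R).

Lemma coef_fps_sum (S : zmodType) (I : Type) (r : seq I) (P : pred I)
    (F : I -> fps S) n :
  (\sum_(i <- r | P i) F i) n = \sum_(i <- r | P i) F i n.
Proof. exact: (big_morph (fun f : fps S => f n) (id1 := 0) (op1 := +%R)). Qed.

Lemma coef_fpsMn (S : zmodType) (f : fps S) p n : (f *+ p) n = f n *+ p.
Proof. by elim: p => [|p IHp] //; rewrite !mulrS -IHp. Qed.

Lemma coef_fpsCM c f n : (fpsC c * f) n = c * f n.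
Proof.
rewrite coef_fpsM big_ord_recl /= subn0 big1 ?addr0 // => i _.
by rewrite mul0r.
Qed.

Lemma fpsCX c n : fpsC c ^+ n = fpsC (c ^+ n).
Proof.
elim: n => [|n IHn]; first by rewrite !expr0.
rewrite !exprS IHn; apply/fpsP => m; rewrite coef_fpsCM /=.
by case: eqP => _; rewrite ?mulr0.
Qed.

Lemma coef_fpsXM f n : (fpsX * f) n = if n is m.+1 then f m else 0.
Proof.
rewrite coef_fpsM; case: n => [|n].
  by rewrite big_ord_recl big_ord0 /= mul0r addr0.
rewrite 2!big_ord_recl big1 /= ?mul0r ?mul1r ?add0r ?addr0 => [|i _].
  by rewrite subSS subn0.
by rewrite mul0r.
Qed.

Lemma coef_fpsXnM p f n : (fpsX ^+ p * f) n = if (p <= n)%N then f (n - p)%N else 0.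
Proof.
elim: p n => [|p IHp] n; first by rewrite expr0 mul1r subn0.
by rewrite exprS -mulrA coef_fpsXM; case: n => [|n] //.
Qed.

Lemma coef_fpsXn p n : (fpsX ^+ p : fps R) n = (n == p)%:R.
Proof.
rewrite -[X in fps_coef X]mulr1 coef_fpsXnM; case: leqP => [le_pn|lt_np].
  by rewrite coef_fps1 subn_eq0 eqn_leq le_pn andbT.
by rewrite ltn_eqF.
Qed.

End Coefficients.

Section Coefficients2.
Variable R : comNzRingType.
Implicit Types (c : R) (A B : ps2 R).

Lemma coef_ps2M A B a b :
  (A * B) a b = \sum_(i < a.+1) \sum_(j < b.+1) A i j * B (a - i)%N (b - j)%N.
Proof. by rewrite coef_fpsM coef_fps_sum. Qed.

Lemma coef_ps2D A B a b : (A + B) a b = A a b + B a b.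
Proof. by []. Qed.

Lemma coef_ps2B A B a b : (A - B) a b = A a b - B a b.
Proof. by []. Qed.

Lemma coef_ps2XnM p A a b :
  (ps2X ^+ p * A) a b = if (p <= a)%N then A (a - p)%N b else 0.
Proof. by rewrite /ps2X coef_fpsXnM; case: ifP. Qed.

Lemma coef_ps2_monom c p q a b :
  (fpsC (fpsC c) * (ps2X ^+ p * ps2U ^+ q)) a b = c *+ ((a == p) && (b == q)).
Proof.
rewrite !coef_fpsCM [ps2X ^+ p * _]mulrC /ps2U fpsCX coef_fpsCM /ps2X coef_fpsXn.
by case: (a == p); rewrite ?mulr1 ?mulr0 ?coef_fpsXn /= ?mulr_natr ?mulr0.
Qed.

Lemma coef_ps2_monomX c p n q a b :
  ((fpsC (fpsC c) * ps2X ^+ p) ^+ n * ps2U ^+ q) a b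
  = c ^+ n *+ ((a == (p * n)%N) && (b == q)).
Proof.
have fpsCCX : fpsC (fpsC c) ^+ n = fpsC (fpsC (c ^+ n)) by rewrite fpsCX fpsCX.
by rewrite -coef_ps2_monom exprMn -exprM -mulrA fpsCCX.
Qed.

Lemma coef_ps2Xn p a b : (ps2X ^+ p : ps2 R) a b = ((a == p) && (b == 0))%:R.
Proof. rewrite /ps2X; by rewrite coef_fpsXn; case: (a == p); rewrite ?coef_fps1. Qed.

Lemma coef_ps2U a b : (ps2U : ps2 R) a b = ((a == 0) && (b == 1))%:R.
Proof. by rewrite /=; case: a. Qed.

Lemma coef_ps2_XU p q a b :
  (ps2X ^+ p * ps2U ^+ q : ps2 R) a b = ((a == p) && (b == q))%:R.
Proof.
have -> : ps2X ^+ p * ps2U ^+ q = fpsC (fpsC 1) * (ps2X ^+ p * ps2U ^+ q) :> ps2 R.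
  by rewrite [fpsC (fpsC 1)](_ : _ = 1) ?mul1r.
exact: coef_ps2_monom.
Qed.

End Coefficients2.

(** * The weight filtration *)

Section Weight.
Variables (R : comNzRingType) (k : nat).
Implicit Types (A B F : ps2 R) (f : fps R).

(** The ideal of series all of whose terms have weight at least [mu], where [x]
    has weight 1 and [u] has weight [k]. *)
Definition wge (mu : nat) (A : ps2 R) : Prop :=
  forall a b, (a + k * b < mu)%N -> A a b = 0.

Lemma wgeW mu nu A : (mu <= nu)%N -> wge nu A -> wge mu A.
Proof. by move=> le_mn wA a b ltab; apply: wA; apply: leq_trans le_mn. Qed.

Lemma wgeD mu A B : wge mu A -> wge mu B -> wge mu (A + B).
Proof. by move=> wA wB a b lt; rewrite !coef_fpsD wA ?wB ?addr0. Qed.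

Lemma wgeN mu A : wge mu A -> wge mu (- A).
Proof. by move=> wA a b lt; rewrite !coef_fpsN wA ?oppr0. Qed.

Lemma wgeB mu A B : wge mu A -> wge mu B -> wge mu (A - B).
Proof. by move=> wA wB; apply: wgeD => //; apply: wgeN. Qed.

Lemma wgeB_eq mu A B a b :
  wge mu (A - B) -> (a + k * b < mu)%N -> A a b = B a b.
Proof. by move=> wAB /wAB /eqP; rewrite !coef_ps2B subr_eq0 => /eqP. Qed.

Lemma wgeB_eqM mu A B a b c :
  wge mu (A - B) -> (a + k * b < mu)%N -> c * A a b = c * B a b.
Proof. by move=> wAB lt; rewrite (wgeB_eq wAB lt). Qed.

Lemma wge_sum mu n (F : 'I_n -> ps2 R) :
  (forall i, wge mu (F i)) -> wge mu (\sum_(i < n) F i).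
Proof. by move=> wF; elim/big_ind: _ => // *; apply: wgeD. Qed.

Lemma wgeM mu nu A B : wge mu A -> wge nu B -> wge (mu + nu) (A * B).
Proof.
move=> wA wB a b lt; rewrite coef_ps2M big1 // => -[i /= lei] _.
rewrite big1 // => -[j /= lej] _.
case: (ltnP (i + k * j) mu) => [/wA ->|le]; first by rewrite mul0r.
rewrite wB ?mulr0 // mulnBr; have := leq_mul (leqnn k) (lej : (j <= b)%N); lia.
Qed.

Lemma wgeX mu A n : wge mu A -> wge (mu * n) (A ^+ n).
Proof.
move=> wA; elim: n => [|n IHn]; first by rewrite muln0.
by rewrite exprS mulnS; apply: wgeM.
Qed.

Lemma wge_ps2X : wge 1 ps2X.
Proof. by move=> [|a] b // _; rewrite -[ps2X]expr1 coef_ps2Xn. Qed.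

Lemma wge_ps2U : wge k ps2U.
Proof.
by move=> a b; rewrite coef_ps2U; case: eqP => //= _; case: eqP => //= ->; lia.
Qed.

(** A difference of powers contains one factor [A - B] and [n - 1] factors
    [A] or [B]; this is what makes substitution weight-triangular. *)
Lemma wgeXB mu nu A B n :
  wge mu A -> wge mu B -> wge nu (A - B) -> wge (nu + mu * n.-1) (A ^+ n - B ^+ n).
Proof.
move=> wA wB wAB; case: n => [|n]; first by rewrite !expr0 subrr.
rewrite subrXX; apply: wgeM => //; apply: wge_sum => -[i /= lei].
have -> : (mu * n = mu * (n - i) + mu * i)%N by rewrite -mulnDr subnK.
by apply: wgeM; apply: wgeX.
Qed.

(** Replacing [A], [B] by [A'], [B'] in [A^p B^q] trades one factor for a
    difference, in either group of factors; the bounds on [la] are stated only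
    when that group is nonempty, because of the truncated predecessor. *)
Lemma wge_monomB mu nu la A B A' B' p q :
  wge 1 A -> wge 1 A' -> wge k B -> wge k B' ->
  wge mu (A - A') -> wge nu (B - B') ->
  (0 < p -> la <= mu + p.-1 + k * q)%N ->
  (0 < q -> la <= p + (nu + k * q.-1))%N ->
  wge la (A ^+ p * B ^+ q - A' ^+ p * B' ^+ q).
Proof.
move=> wA wA' wB wB' dA dB lep leq.
have -> : A ^+ p * B ^+ q - A' ^+ p * B' ^+ q
        = (A ^+ p - A' ^+ p) * B ^+ q + A' ^+ p * (B ^+ q - B' ^+ q) by ring.
apply: wgeD.
  case: p lep {leq} => [|p] lep; first by rewrite !expr0 subrr mul0r.
  apply: wgeW (lep isT) _; apply: wgeM; last exact: wgeX.
  by rewrite -[X in (_ + X)%N]mul1n; apply: wgeXB.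
case: q leq {lep} => [|q] leq; first by rewrite !expr0 subrr mulr0.
apply: wgeW (leq isT) _; apply: wgeM; last exact: wgeXB.
by rewrite -[X in wge X]mul1n; apply: wgeX.
Qed.

(** Fixed point theorem for the weight topology: the iterates from 0 become
    stationary in each weight. *)
Lemma wge_contraction (T : ps2 R -> ps2 R) :
  (forall mu A B, wge mu (A - B) -> wge mu.+1 (T A - T B)) ->
  exists A, T A = A.
Proof.
move=> contrT; pose s n := iter n T 0.
have sS n : wge n (s n.+1 - s n).
  by elim: n => [|n IHn] //; apply: (contrT n).
have s_stable n d : wge n (s (n + d)%N - s n).
  elim: d => [|d IHd]; first by rewrite addn0 subrr.
  rewrite addnS -(subrKA (s (n + d)%N)); apply: wgeD => //.
  by apply: wgeW (sS _); rewrite leq_addr.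
pose A : ps2 R := Fps (fun a => Fps (fun b => s (a + k * b).+1 a b)).
have Alim n : wge n (A - s n).
  move=> a b lt; rewrite !coef_ps2B /=.
  set m := (a + k * b).+1 in lt *.
  rewrite -(subnKC lt) -(wgeB_eq (s_stable m (n - m)%N)) //.
  by rewrite subrr.
exists A; apply: ps2P => a b; set n := (a + k * b)%N.
by rewrite (wgeB_eq (contrT n _ _ (Alim n))) ?(wgeB_eq (Alim n.+1)) ?ltnS.
Qed.

(** * Substitution and weight *)

Lemma subst1B f g A : subst1 (f - g) A = subst1 f A - subst1 g A.
Proof.
apply: ps2P => a b; rewrite !coef_ps2B /= -sumrB.
by apply: eq_bigr => i _; rewrite mulrBl.
Qed.

Lemma wge_subst1 mu f A :
  wge k A -> (forall n, (k * n < mu)%N -> f n = 0) -> wge mu (subst1 f A).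
Proof.
move=> wA f0 a b lt /=; rewrite big1 // => -[n /= _] _.
case: (ltnP (k * n) mu) => [/f0 ->|le]; first by rewrite mul0r.
by rewrite (wgeX (n := n) wA (a := a)) ?mulr0 //; apply: leq_trans le.
Qed.

(** In weight [k n] only the first nonzero coefficient of [f] is seen, and only
    through the lowest part [B] of [A]. *)
Lemma subst1_lead f A B n a b : (0 < k)%N ->
  wge k A -> wge k B -> wge k.+1 (A - B) ->
  (forall m, (m < n)%N -> f m = 0) -> (a + k * b = k * n)%N ->
  subst1 f A a b = f n * (B ^+ n) a b.
Proof.
move=> k_gt0 wA wB wAB f0 eqab /=.
(* The truncation of the sum in [subst1] keeps the term of index [n]. *)
have ltn : (n < (a + b).+1)%N.
  by rewrite ltnS -(leq_pmul2l k_gt0) -eqab mulnDr leq_add2r leq_pmull.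
rewrite (bigD1 (Ordinal ltn)) //= big1 ?addr0 => [|[m /= lem] /eqP neq].
  apply: wgeB_eqM (wgeXB (n := n) wA wB wAB) _.
  case: n {f0 ltn} eqab => [|n] eqab; rewrite eqab ?muln0 ?mulnS //=; lia.
case: (ltngtP m n) => [/f0 ->|lt|eqmn]; first by rewrite mul0r.
  by rewrite (wgeX (n := m) wA (a := a)) ?mulr0 // eqab ltn_pmul2l.
by case: neq; apply: val_inj.
Qed.

Lemma mulr_zero_eq (c x y : R) : c = 0 -> c * x = c * y.
Proof. by move=> ->; rewrite !mul0r. Qed.

Lemma coef_subst2 F A B a b : subst2 F A B a b =
  \sum_(j < (a + b).+1) \sum_(m < (a + b).+1) F j m * (A ^+ j * B ^+ m) a b.
Proof. by []. Qed.

Lemma subst2B F F' A B : subst2 (F - F') A B = subst2 F A B - subst2 F' A B.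
Proof.
apply: ps2P => a b; rewrite coef_ps2B 2!coef_subst2 -sumrB.
apply: eq_bigr => i _; rewrite -sumrB; apply: eq_bigr => j _.
by rewrite -mulrBl.
Qed.

(** A substitution that is the identity to lowest weight preserves the lowest
    weight part of [F]. *)
Lemma subst2_lead F A B a b :
  (0 < k)%N -> wge 1 A -> wge k B -> wge 2 (A - ps2X) -> wge k.+1 (B - ps2U) ->
  wge (a + k * b) F -> subst2 F A B a b = F a b.
Proof.
move=> k_gt0 wA wB dA dB wF.
have main p q : F p q * (A ^+ p * B ^+ q) a b = F p q *+ ((a == p) && (b == q)).
  rewrite -mulr_natr -coef_ps2_XU.
  case: (ltnP (p + k * q) (a + k * b)) => [lt|le].
    exact: (mulr_zero_eq _ _ (wF _ _ lt)).
  apply: (@wgeB_eqM (p + k * q).+1); last by rewrite ltnS.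
  apply: (wge_monomB wA wge_ps2X wB wge_ps2U dA dB); first by case: (p) => //=; lia.
  by case: (q) => //= q' _; rewrite mulnS; lia.
have lta : (a < (a + b).+1)%N by lia.
have ltb : (b < (a + b).+1)%N by lia.
rewrite coef_subst2.
under eq_bigr => p _ do under eq_bigr => q _ do rewrite main.
rewrite (bigD1 (Ordinal lta)) //= (bigD1 (Ordinal ltb)) //= !eqxx mulr1n.
rewrite big1 => [|[q /= ltq] /eqP neq]; last first.
  by case: eqP => //= eqbq; case: neq; apply: val_inj.
rewrite big1 ?addr0 // => -[p /= ltp] /eqP neq; rewrite big1 // => -[q /= _] _.
by case: eqP => // eqap; case: neq; apply: val_inj.
Qed.

(** [A] has weight 1 and [B] has weight [k], so replacing one factor in a monomial
    of weight above [k] loses at most weight 1 on the side of [A] and [k] on the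
    side of [B]: the strict bound on [F] yields one more than [mu]. *)
Lemma wge_subst2B mu F A B A' B' :
  wge k.+1 F -> wge 1 A -> wge 1 A' -> wge k B -> wge k B' ->
  wge (mu.+1 - k) (A - A') -> wge mu (B - B') -> (k <= mu)%N ->
  wge mu.+1 (subst2 F A B - subst2 F A' B').
Proof.
move=> wF wA wA' wB wB' dA dB lek a b lt.
apply/eqP; rewrite coef_ps2B subr_eq0; apply/eqP.
rewrite [LHS]coef_subst2 [RHS]coef_subst2.
apply: eq_bigr => p _; apply: eq_bigr => q _.
case: (ltnP (p + k * q) k.+1) => [lt1|le].
  exact: (mulr_zero_eq _ _ (wF _ _ lt1)).
apply: (@wgeB_eqM mu.+1); last exact: lt.
apply: (wge_monomB wA wA' wB wB' dA dB).
  by case: (nat_of_ord p) le => //= p'; lia.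
by case: (nat_of_ord q) le => //= q'; rewrite mulnS; lia.
Qed.

End Weight.

(** * Weight-triangular equations *)

(** An equation [E U = 0] whose part of each weight [mu > n] is [- U] plus terms
    that depend on coefficients of [U] known earlier.  Within one weight the
    coefficients of [x^a u^b] with [s a] come first, and the others may depend on
    them. *)
Section Triangular.
Variables (R : comNzRingType) (k n : nat) (s : pred nat) (E : ps2 R -> ps2 R).
Implicit Types U V : ps2 R.

Hypothesis E_gt : forall U, wge k n.+1 (E U).
Hypothesis E_slot : forall U V a b,
  (n < a + k * b)%N -> wge k (a + k * b) (U - V) -> s a ->
  E U a b - E V a b = V a b - U a b.
Hypothesis E_rest : forall U V a b,
  (n < a + k * b)%N -> wge k (a + k * b) (U - V) ->
  (forall c d, s c -> (c + k * d < (a + k * b).+1)%N -> U c d = V c d) ->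
  ~~ s a -> E U a b - E V a b = V a b - U a b.

Definition adjust_slots U : ps2 R := Fps (fun a => Fps (fun b =>
  if s a then U a b + E U a b else U a b)).

Definition adjust U : ps2 R := Fps (fun a => Fps (fun b =>
  if (a + k * b <= n)%N then 0
  else if s a then U a b + E U a b
  else U a b + E (adjust_slots U) a b)).

Let addr_cross (u v r t : R) : r - t = v - u -> u + r = v + t.
Proof.
move=> h; apply/eqP; rewrite -subr_eq0 opprD addrACA h; apply/eqP; ring.
Qed.

(** One sweep of the iteration: where [E U] is [c - U] with [c] already
    determined, [U + E U] is the determined value.  The second kind of coefficient
    has to be computed from [adjust_slots U], whose slots are already correct in
    the current weight. *)
Lemma adjust_contraction mu U V :
  wge k mu (U - V) -> wge k mu.+1 (adjust U - adjust V).
Proof.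
move=> dUV.
have slot_eq c d : s c -> (n < c + k * d)%N -> (c + k * d <= mu)%N ->
    U c d + E U c d = V c d + E V c d.
  move=> sc n_cd le; apply: addr_cross.
  by apply: (E_slot n_cd) => //; apply: wgeW le dUV.
move=> a b; rewrite ltnS => le; apply/eqP; rewrite coef_ps2B subr_eq0; apply/eqP.
rewrite /=; case: leqP => // n_ab; case: ifP => [sa|/negbT sa]; first exact: slot_eq.
have dab : wge k (a + k * b) (U - V) by apply: wgeW le dUV.
have adj_eq c d : s c -> (c + k * d < (a + k * b).+1)%N ->
    adjust_slots U c d = adjust_slots V c d.
  move=> sc; rewrite ltnS => lecd /=; rewrite sc.
  (* Below the threshold [E] vanishes and [adjust_slots] changes nothing. *)
  case: (leqP (c + k * d) n) => [le_n|n_cd]; last first.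
    by apply: slot_eq => //; apply: leq_trans le.
  rewrite (E_gt U) ?(E_gt V) ?ltnS // !addr0; apply: wgeB_eq dUV _.
  by apply: leq_ltn_trans le_n _; apply: leq_trans n_ab le.
have d_adj : wge k (a + k * b) (adjust_slots U - adjust_slots V).
  move=> c d lt; apply/eqP; rewrite coef_ps2B subr_eq0; apply/eqP.
  case sc: (s c); first by apply: adj_eq => //; apply: leqW.
  by rewrite /= sc; apply: wgeB_eq dab lt.
have := E_rest n_ab d_adj adj_eq sa.
by rewrite /= (negbTE sa); apply: addr_cross.
Qed.

Lemma triangular_solution : exists U, E U = 0.
Proof.
have [U fixU] := wge_contraction adjust_contraction; exists U.
have addK (c r : R) : c + r = c -> r = 0 by rewrite -[RHS]addr0 => /addrI.
have fix_ab a b : adjust U a b = U a b by rewrite fixU.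
have slot0 a b : s a -> E U a b = 0.
  move=> sa; have := fix_ab a b; rewrite /= sa.
  by case: leqP => [le _|_ /addK //]; apply: E_gt.
have adjU : adjust_slots U = U.
  by apply: ps2P => a b /=; case: ifP => // /slot0 ->; rewrite addr0.
apply: ps2P => a b; case sa: (s a); first exact: slot0.
have := fix_ab a b; rewrite /= sa adjU.
by case: leqP => [le _|_ /addK //]; apply: E_gt.
Qed.

End Triangular.

(** * Hypersurfaces *)

Section Parts.
Variables (R : realType) (k : nat).
Implicit Types A B : ps2 R[i].

Lemma ps2_ReD A B : ps2_Re (A + B) = ps2_Re A + ps2_Re B.
Proof.
by apply: ps2P => a b; rewrite [RHS]coef_ps2D /=; case: (A a b); case: (B a b).
Qed.

Lemma ps2_ImD A B : ps2_Im (A + B) = ps2_Im A + ps2_Im B.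
Proof.
by apply: ps2P => a b; rewrite [RHS]coef_ps2D /=; case: (A a b); case: (B a b).
Qed.

Lemma ps2_ReB A B : ps2_Re (A - B) = ps2_Re A - ps2_Re B.
Proof. by apply/esym/eqP; rewrite subr_eq -ps2_ReD subrK. Qed.

Lemma ps2_ImB A B : ps2_Im (A - B) = ps2_Im A - ps2_Im B.
Proof. by apply/esym/eqP; rewrite subr_eq -ps2_ImD subrK. Qed.

Lemma ps2_Re_complex (C D : ps2 R) : ps2_Re (ps2_complex C D) = C.
Proof. exact: ps2P. Qed.

Lemma ps2_Im_complex (C D : ps2 R) : ps2_Im (ps2_complex C D) = D.
Proof. exact: ps2P. Qed.

Lemma wge_Re mu A : wge k mu A -> wge k mu (ps2_Re A).
Proof. by move=> wA a b lt /=; rewrite wA. Qed.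

Lemma wge_Im mu A : wge k mu A -> wge k mu (ps2_Im A).
Proof. by move=> wA a b lt /=; rewrite wA. Qed.

Lemma wge_complex mu (C D : ps2 R) :
  wge k mu C -> wge k mu D -> wge k mu (ps2_complex C D).
Proof. by move=> wC wD a b lt /=; rewrite wC ?wD. Qed.

End Parts.

Section LeadingPart.
Variables (R : realType) (k : nat).
Hypothesis k_gt0 : (0 < k)%N.

(** The lowest weight part of [w] on [M], that is, [w] on the model [v = x^k]. *)
Definition model_w : ps2 R[i] := ps2_complex ps2U (ps2X ^+ k).

Lemma wge_ps2Xk : wge k k (ps2X ^+ k : ps2 R).
Proof. by rewrite -[X in wge _ X]mul1n; apply: wgeX; apply: wge_ps2X. Qed.

Lemma wge_model_w : wge k k model_w.
Proof. apply: wge_complex; [exact: wge_ps2U|exact: wge_ps2Xk]. Qed.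

Lemma coef_model_wX n a b : (model_w ^+ n) a b =
  \sum_(i < n.+1)
     (Complex 0 1 ^+ i *+ ((a == (k * i)%N) && (b == (n - i)%N))) *+ 'C(n, i).
Proof.
have -> : model_w = ps2U + fpsC (fpsC (Complex 0 1)) * ps2X ^+ k.
  apply: ps2P => c d; rewrite !coef_fpsD coef_ps2U !coef_fpsCM coef_ps2Xn /=.
  have := coef_ps2U R c d; rewrite /= => ->.
  have := coef_ps2Xn R k c d; rewrite /= => ->.
  by case: (_ && _); case: (_ && _); simpc.
rewrite exprDn !coef_fps_sum; apply: eq_bigr => i _.
rewrite !coef_fpsMn; congr (_ *+ _).
by rewrite mulrC; apply: coef_ps2_monomX.
Qed.

Lemma coef_model_w0 n : (model_w ^+ n) 0%N n = 1.
Proof.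
rewrite coef_model_wX big_ord_recl big1 ?addr0 => [|i _].
  by rewrite muln0 subn0 !eqxx bin0 expr0.
by rewrite lift0 eq_sym muln_eq0 !(@gtn_eqF 0) //; apply: mul0rn.
Qed.

Lemma coef_model_wk n : (0 < n)%N -> (model_w ^+ n) k n.-1 = Complex 0 n%:R.
Proof.
case: n => // n _.
rewrite coef_model_wX big_ord_recl big_ord_recl big1 ?addr0 => [|i _].
  rewrite muln0 (gtn_eqF k_gt0) lift0 muln1 subn1 !eqxx bin1 expr1.
  have natmul_i m : (Complex 0 1 : R[i]) *+ m = Complex 0 m%:R.
    by elim: m => // m IHm; rewrite !mulrS IHm; simpc.
  by rewrite -[RHS]add0r; congr (_ + _); apply: natmul_i.
rewrite !lift0 -[X in X == _]muln1 eqn_pmul2l // ltn_eqF //; exact: mul0rn.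
Qed.

(** The linearization of [Im phi(w) - (x + Re psi(w))^k] at [psi = phi = 0]. *)
Definition linear_part (psi phi : fps R[i]) (w : ps2 R[i]) : ps2 R :=
  ps2_Im (subst1 phi w) - (ps2X ^+ k.-1 * ps2_Re (subst1 psi w)) *+ k.

End LeadingPart.

(** The hypotheses on [psi] and [phi] say that they contribute to [linear_part]
    in weight [mu] and above only: [phi_n w^n] has weight [k n], and [psi_n w^n]
    multiplied by [x^(k-1)] has weight [k n + k - 1].  The weights of the two
    kinds are distinct modulo [k], so in each of the four lemmas below one of the
    two series contributes nothing. *)
Section Slots.
Variables (R : realType) (k : nat) (psi phi : fps R[i]) (w : ps2 R[i]) (mu : nat).
Hypotheses (k_gt1 : (1 < k)%N) (w_k : wge k k w).
Hypothesis w_lead : wge k k.+1 (w - model_w R k).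
Hypothesis psi_mu : forall m, (k * m + k.-1 < mu)%N -> psi m = 0.
Hypothesis phi_mu : forall m, (k * m < mu)%N -> phi m = 0.

Let k_gt0 : (0 < k)%N. Proof. exact: ltnW. Qed.

Lemma wge_linear_part : wge k mu (linear_part k psi phi w).
Proof.
apply: wgeB; first by apply: wge_Im; apply: wge_subst1.
move=> a b lt; rewrite !coef_fpsMn coef_ps2XnM; case: leqP => le; last exact: mul0rn.
rewrite (@wge_Re _ k (mu - k.-1)) ?mul0rn //; last by lia.
by apply: wge_subst1 => // m ltm; apply: psi_mu; lia.
Qed.

Let Im_phi a b n : (a + k * b = k * n)%N -> (mu = k * n)%N ->
  ps2_Im (subst1 phi w) a b = complex.Im (phi n * (model_w R k ^+ n) a b).
Proof.
move=> eqab eqmu /=; rewrite -(subst1_lead k_gt0 w_k (@wge_model_w R k) w_lead) //.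
by move=> m ltm; apply: phi_mu; rewrite eqmu ltn_pmul2l.
Qed.

Let Re_psi a b n : (a + k * b = k * n)%N -> (mu = k * n + k.-1)%N ->
  ps2_Re (subst1 psi w) a b = complex.Re (psi n * (model_w R k ^+ n) a b).
Proof.
move=> eqab eqmu /=; rewrite -(subst1_lead k_gt0 w_k (@wge_model_w R k) w_lead) //.
by move=> m ltm; apply: psi_mu; rewrite eqmu ltn_add2r ltn_pmul2l.
Qed.

Lemma linear_part_0 n : (mu = k * n)%N ->
  linear_part k psi phi w 0%N n = complex.Im (phi n).
Proof.
move=> eqmu; rewrite coef_ps2B !coef_fpsMn coef_ps2XnM.
rewrite leqNgt ltn_predRL k_gt1 /= mul0rn subr0.
by have /= -> := @Im_phi 0%N n n erefl eqmu; rewrite coef_model_w0 // mulr1.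
Qed.

Lemma linear_part_k n : (0 < n)%N -> (mu = k * n)%N ->
  linear_part k psi phi w k n.-1 = n%:R * complex.Re (phi n).
Proof.
move=> n_gt0 eqmu; rewrite coef_ps2B !coef_fpsMn coef_ps2XnM leq_pred.
rewrite (@wge_Re _ k (k * n)) ?mul0rn ?subr0; first last.
- by case: (n) n_gt0 => // n' _; rewrite mulnS /=; lia.
- apply: wge_subst1 => // m; rewrite ltn_pmul2l // => ltm; apply: psi_mu.
  by have := leq_mul (leqnn k) ltm; rewrite mulnS; lia.
rewrite (@Im_phi k n.-1 n) //; last by rewrite -mulnS prednK.
by rewrite coef_model_wk //; case: (phi n) => c d /=; ring.
Qed.

Lemma linear_part_k1 n : (mu = k * n + k.-1)%N ->
  linear_part k psi phi w k.-1 n = - (k%:R * complex.Re (psi n)).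
Proof.
move=> eqmu; rewrite coef_ps2B !coef_fpsMn coef_ps2XnM leqnn subnn.
rewrite (@wge_Im _ k (k * n.+1)); first last.
- by rewrite mulnS; lia.
- apply: wge_subst1 => // m; rewrite ltn_pmul2l // ltnS => lem; apply: phi_mu.
  by have := leq_mul (leqnn k) lem; lia.
by rewrite (@Re_psi 0%N n n) // coef_model_w0 // mulr1 sub0r mulr_natl.
Qed.

Lemma linear_part_2k1 n : (0 < n)%N -> (mu = k * n + k.-1)%N ->
  linear_part k psi phi w (2 * k).-1 n.-1 = k%:R * n%:R * complex.Im (psi n).
Proof.
move=> n_gt0 eqmu; rewrite coef_ps2B !coef_fpsMn coef_ps2XnM.
rewrite (@wge_Im _ k (k * n.+1)); first last.
- by case: (n) n_gt0 => // n' _; rewrite !mulnS /=; lia.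
- apply: wge_subst1 => // m; rewrite ltn_pmul2l // ltnS => lem; apply: phi_mu.
  by have := leq_mul (leqnn k) lem; lia.
have -> : ((2 * k).-1 - k.-1 = k)%N by lia.
have -> : (k.-1 <= (2 * k).-1)%N by lia.
rewrite (@Re_psi k n.-1 n) //; last by rewrite -mulnS prednK.
by rewrite coef_model_wk //; case: (psi n) => c d /=; rewrite -mulr_natl; ring.
Qed.

End Slots.

(** * The residual *)

Section Residual.
Variables (R : realType) (k : nat) (G : ps2 R).
Hypotheses (k_gt2 : (2 < k)%N) (G_gt : weight_gt k G).
Implicit Types (psi phi : fps R[i]) (H : ps2 R).

Let k_gt0 : (0 < k)%N. Proof. by lia. Qed.
Let k_gt1 : (1 < k)%N. Proof. by lia. Qed.

Lemma weight_gtP H : weight_gt k H <-> wge k k.+1 H.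
Proof.
split=> wH a b; first by apply: contraTeq => /wH; rewrite -leqNgt.
by apply: contraR; rewrite -leqNgt -ltnS => lt; rewrite (wH a b lt).
Qed.

Definition surface_w : ps2 R[i] := ps2_complex ps2U (ps2X ^+ k + G).
Definition new_x psi : ps2 R := ps2X + ps2_Re (subst1 psi surface_w).
Definition new_u phi : ps2 R := ps2U + ps2_Re (subst1 phi surface_w).

Definition residual psi phi H : ps2 R :=
  ps2X ^+ k + G + ps2_Im (subst1 phi surface_w)
  - (new_x psi ^+ k + subst2 H (new_x psi) (new_u phi)).

(** Only [Re z = x] and [w] enter the equation of the image, whatever [y] is. *)
Lemma residual_eq0 psi phi H :
  residual psi phi H = 0 -> takes_into k psi phi G H.
Proof.
move=> /eqP; rewrite subr_eq0 => /eqP E y z w.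
rewrite /on_hypersurface !ps2_ReD ps2_ImD.
by rewrite ps2_Im_complex !ps2_Re_complex.
Qed.

Lemma wge_surface_w : wge k k surface_w.
Proof.
apply: wge_complex; first exact: wge_ps2U.
apply: wgeD; first exact: wge_ps2Xk.
by apply: wgeW (leqnSn k) _; apply/weight_gtP.
Qed.

Lemma surface_w_lead : wge k k.+1 (surface_w - model_w R k).
Proof.
move=> a b lt; rewrite !coef_ps2B /=.
have /weight_gtP -> // := G_gt; rewrite addr0; exact: subrr.
Qed.

Lemma wge_psi_w psi : psi 0%N = 0 -> wge k k (subst1 psi surface_w).
Proof.
move=> psi0; apply: wge_subst1 wge_surface_w _ => -[//|n].
by rewrite mulnS; lia.
Qed.

Lemma wge_phi_w phi : phi 0%N = 0 -> phi 1%N = 0 ->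
  wge k (2 * k) (subst1 phi surface_w).
Proof.
move=> phi0 phi1; apply: wge_subst1 wge_surface_w _ => -[//|[//|n]].
by rewrite !mulnS; lia.
Qed.

Lemma wge_new_x psi : psi 0%N = 0 -> wge k 1 (new_x psi).
Proof.
move=> psi0; apply: wgeD; first exact: wge_ps2X.
by apply: wgeW k_gt0 _; apply: wge_Re; apply: wge_psi_w.
Qed.

Lemma wge_new_u phi : phi 0%N = 0 -> phi 1%N = 0 -> wge k k (new_u phi).
Proof.
move=> phi0 phi1; apply: wgeD; first exact: wge_ps2U.
by apply: (@wgeW _ _ _ (2 * k)); [lia|apply: wge_Re; apply: wge_phi_w].
Qed.

Lemma new_xB psi psi' :
  new_x psi - new_x psi' = ps2_Re (subst1 (psi - psi') surface_w).
Proof. by rewrite subst1B ps2_ReB /new_x; ring. Qed.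

Lemma new_uB phi phi' :
  new_u phi - new_u phi' = ps2_Re (subst1 (phi - phi') surface_w).
Proof. by rewrite subst1B ps2_ReB /new_u; ring. Qed.

Lemma wge_new_xBX psi : psi 0%N = 0 -> wge k k (new_x psi - ps2X).
Proof.
by move=> psi0; rewrite /new_x addrC addKr; apply: wge_Re; apply: wge_psi_w.
Qed.

Lemma wge_new_x_lead psi : psi 0%N = 0 -> wge k 2 (new_x psi - ps2X).
Proof. by move=> psi0; apply: (@wgeW _ _ _ k); [lia|apply: wge_new_xBX]. Qed.

Lemma wge_new_u_lead phi : phi 0%N = 0 -> phi 1%N = 0 ->
  wge k k.+1 (new_u phi - ps2U).
Proof.
move=> phi0 phi1; rewrite /new_u addrC addKr.
by apply: (@wgeW _ _ _ (2 * k)); [lia|apply: wge_Re; apply: wge_phi_w].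
Qed.

Lemma wge_subst2_new psi phi H mu : psi 0%N = 0 -> phi 0%N = 0 -> phi 1%N = 0 ->
  wge k mu H -> wge k mu (subst2 H (new_x psi) (new_u phi)).
Proof.
move=> psi0 phi0 phi1 wH a b lt.
rewrite (subst2_lead k_gt0 (wge_new_x psi0) (wge_new_u phi0 phi1)) ?wH //.
- exact: wge_new_x_lead.
- exact: wge_new_u_lead.
by apply: wgeW (ltnW lt) _.
Qed.

Lemma wge_residual psi phi H : psi 0%N = 0 -> phi 0%N = 0 -> phi 1%N = 0 ->
  weight_gt k H -> wge k k.+1 (residual psi phi H).
Proof.
move=> psi0 phi0 phi1 /weight_gtP wH.
have -> : residual psi phi H =
    (G + ps2_Im (subst1 phi surface_w) - subst2 H (new_x psi) (new_u phi))
    - (new_x psi ^+ k - ps2X ^+ k) by rewrite /residual; ring.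
apply: wgeB; first apply: wgeB; first apply: wgeD.
- exact/weight_gtP.
- by apply: (@wgeW _ _ _ (2 * k)); [lia|apply: wge_Im; apply: wge_phi_w].
- exact: wge_subst2_new.
apply: wgeW (wgeXB (n := k) (wge_new_x psi0) (@wge_ps2X _ _) (wge_new_xBX psi0)).
by lia.
Qed.

(** The algebra behind [residualB].  There [s11], [s12], [s22] are the values of
    [H] at the new arguments, of [H] at the old ones and of [H'] at the old ones,
    so that the change of arguments is separated from the change of [H]. *)
Lemma residualB_ring (S : comNzRingType) (W I I' E E' s11 s12 s22 dx P c D : S) :
  E - E' = dx * P ->
  W + I - (E + s11) - (W + I' - (E' + s22)) - (I - I' - dx * c - D)
  = - (dx * (P - c)) - (s11 - s12) - (s12 - s22 - D).
Proof. by move=> dE; rewrite mulrBr -dE; ring. Qed.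

(** The change of [(x + Re psi(w))^k] is [dx P] with [dx] of weight at least
    [mu + 1 - k] and [P] equal to [k x^(k-1)] up to terms of weight at least [k];
    in [H] the change of the arguments is invisible up to weight [mu], because [H]
    starts above weight [k], and the change of [H] itself is seen with its
    arguments replaced by [x], [u]. *)
Lemma residualB mu psi phi H psi' phi' H' : (k < mu)%N ->
  psi 0%N = 0 -> phi 0%N = 0 -> phi 1%N = 0 -> weight_gt k H ->
  psi' 0%N = 0 -> phi' 0%N = 0 -> phi' 1%N = 0 -> weight_gt k H' ->
  (forall n, (k * n + k.-1 < mu)%N -> psi n = psi' n) ->
  (forall n, (k * n < mu)%N -> phi n = phi' n) ->
  wge k mu (H - H') ->
  wge k mu.+1 (residual psi phi H - residual psi' phi' H'
    - (linear_part k (psi - psi') (phi - phi') surface_w - (H - H'))).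
Proof.
move=> k_mu psi0 phi0 phi1 /weight_gtP wH psi0' phi0' phi1' /weight_gtP wH'.
move=> eq_psi eq_phi dH.
set dx := new_x psi - new_x psi'.
have w_dx : wge k (mu.+1 - k) dx.
  rewrite /dx new_xB; apply: wge_Re; apply: wge_subst1 wge_surface_w _ => n lt.
  by rewrite coef_fpsD coef_fpsN eq_psi ?subrr //; lia.
have w_du : wge k mu (new_u phi - new_u phi').
  rewrite new_uB; apply: wge_Re; apply: wge_subst1 wge_surface_w _ => n lt.
  by rewrite coef_fpsD coef_fpsN eq_phi ?subrr.
pose P := \sum_(i < k) new_x psi ^+ (k.-1 - i) * new_x psi' ^+ i.
have powB : new_x psi ^+ k - new_x psi' ^+ k = dx * P by rewrite subrXX.
have w_P : wge k k (P - ps2X ^+ k.-1 *+ k).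
  have -> : ps2X ^+ k.-1 *+ k
          = \sum_(i < k) (ps2X : ps2 R) ^+ (k.-1 - i) * ps2X ^+ i.
    rewrite -[X in _ *+ X]card_ord -sumr_const; apply: eq_bigr => i _.
    by rewrite -exprD subnK // -ltnS prednK.
  rewrite /P -sumrB; apply: wge_sum => i.
  have lei : (i <= k.-1)%N by rewrite -ltnS prednK.
  have wX := @wge_ps2X R k; have wx := wge_new_x psi0; have wx' := wge_new_x psi0'.
  have -> :
    new_x psi ^+ (k.-1 - i) * new_x psi' ^+ i - ps2X ^+ (k.-1 - i) * ps2X ^+ i
    = (new_x psi ^+ (k.-1 - i) - ps2X ^+ (k.-1 - i)) * new_x psi' ^+ i
      + ps2X ^+ (k.-1 - i) * (new_x psi' ^+ i - ps2X ^+ i) by ring.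
  apply: wgeD.
    rewrite -[X in wge _ X]addn0; apply: wgeM; last exact: wgeW (wgeX wx').
    by apply: wgeW (wgeXB wx wX (wge_new_xBX psi0)); rewrite leq_addr.
  rewrite -[X in wge _ X]add0n; apply: wgeM; first exact: wgeW (wgeX wX).
  by apply: wgeW (wgeXB wx' wX (wge_new_xBX psi0')); rewrite leq_addr.
have -> : residual psi phi H - residual psi' phi' H'
    - (linear_part k (psi - psi') (phi - phi') surface_w - (H - H'))
  = - (dx * (P - ps2X ^+ k.-1 *+ k))
    - (subst2 H (new_x psi) (new_u phi) - subst2 H (new_x psi') (new_u phi'))
    - (subst2 (H - H') (new_x psi') (new_u phi') - (H - H')).
  have -> : linear_part k (psi - psi') (phi - phi') surface_w
     = ps2_Im (subst1 phi surface_w) - ps2_Im (subst1 phi' surface_w)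
       - dx * (ps2X ^+ k.-1 *+ k).
    by rewrite /linear_part -new_xB subst1B ps2_ImB -mulrnAl mulrC.
  by rewrite subst2B; apply: residualB_ring powB.
apply: wgeB; first apply: wgeB.
- apply: wgeN; apply: wgeW (wgeM w_dx w_P); lia.
- apply: (wge_subst2B wH (wge_new_x psi0) (wge_new_x psi0') (wge_new_u phi0 phi1)
    (wge_new_u phi0' phi1') w_dx w_du); exact: ltnW.
move=> a b; rewrite ltnS => le; rewrite !coef_ps2B.
rewrite (subst2_lead k_gt0 (wge_new_x psi0') (wge_new_u phi0' phi1')) //.
- by rewrite !coef_ps2B subrr.
- exact: wge_new_x_lead.
- exact: wge_new_u_lead.
exact: wgeW le dH.
Qed.

End Residual.

(** * Solving for the normal form *)

Section Normalization.
Variables (R : realType) (k : nat) (G : ps2 R).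
Hypotheses (k_gt2 : (2 < k)%N) (G_gt : weight_gt k G).
Implicit Types (U V : ps2 R).

Let k_gt0 : (0 < k)%N. Proof. by lia. Qed.
Let k_gt1 : (1 < k)%N. Proof. by lia. Qed.

(** The powers of [x] that are absent from a normal form. *)
Definition slot (j : nat) : bool := j \in [:: 0; k.-1; k; (2 * k).-1]%N.

(** [psi_of], [phi_of] and [graph_of] unpack the unknown [U].  The scalings make
    the slot coefficients of the residual depend on those of [U] as [- U].  The
    coefficients of [U] of weight at most [k] are ignored, and this is also why
    [phi_of] starts with [n = 2]: the slots [u] and [x^k] have weight [k]. *)
Definition psi_of U : fps R[i] := Fps (fun n =>
  if n is m.+1
  then Complex (U k.-1 n / k%:R) (- (U (2 * k).-1 m / (k%:R * n%:R))) else 0).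

Definition phi_of U : fps R[i] := Fps (fun n =>
  if n is m.+2 then Complex (- (U k m.+1 / n%:R)) (- U 0%N n) else 0).

Definition graph_of U : ps2 R := Fps (fun j => Fps (fun m =>
  if slot j || (j + k * m <= k)%N then 0 else U j m)).

Definition residual_of U : ps2 R :=
  residual k G (psi_of U) (phi_of U) (graph_of U).

Lemma weight_gt_graph_of U : weight_gt k (graph_of U).
Proof.
by move=> j m /=; case: ifP => [|/norP[_]]; rewrite ?eqxx // ltnNge.
Qed.

Lemma normal_form_graph_of U : normal_form k (graph_of U).
Proof.
split; first exact: weight_gt_graph_of.
have slot0 j : slot j -> graph_of U j = 0.
  by move=> sj; apply/fpsP => m /=; rewrite sj.
by split; apply: slot0; rewrite /slot !inE eqxx ?orbT.
Qed.

Lemma psi_of_eq mu U V :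
  (forall a b, slot a -> (a + k * b < mu)%N -> U a b = V a b) ->
  forall n, (k * n + k.-1 < mu)%N -> psi_of U n = psi_of V n.
Proof.
move=> eqUV [|n] //= lt; rewrite !eqUV // /slot ?inE ?eqxx ?orbT //.
  by move: lt; rewrite mulnS; lia.
by rewrite addnC.
Qed.

Lemma phi_of_eq mu U V :
  (forall a b, slot a -> (a + k * b < mu)%N -> U a b = V a b) ->
  forall n, (k * n < mu)%N -> phi_of U n = phi_of V n.
Proof.
move=> eqUV [|[|n]] //= lt; rewrite !eqUV // /slot ?inE ?eqxx ?orbT //.
by rewrite -mulnS.
Qed.

Lemma graph_of_eq mu U V : wge k mu (U - V) -> wge k mu (graph_of U - graph_of V).
Proof.
move=> dUV a b lt; rewrite coef_ps2B /=; case: ifP => _; first exact: subrr.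
by rewrite (wgeB_eq dUV lt) subrr.
Qed.

Lemma residual_ofB mu U V a b : (k < mu)%N -> wge k mu (U - V) ->
  (a + k * b = mu)%N ->
  residual_of U a b - residual_of V a b =
  linear_part k (psi_of U - psi_of V) (phi_of U - phi_of V) (surface_w k G) a b
  - (graph_of U a b - graph_of V a b).
Proof.
move=> k_mu dUV eqab.
have eqUV c d : slot c -> (c + k * d < mu)%N -> U c d = V c d.
  by move=> _; apply: wgeB_eq dUV.
have ltab : (a + k * b < mu.+1)%N by rewrite eqab.
have coefB (A B L C D : ps2 R) : wge k mu.+1 (A - B - (L - (C - D))) ->
    A a b - B a b = L a b - (C a b - D a b).
  by move=> /wgeB_eq; apply.
apply: coefB; apply: residualB => //; try exact: weight_gt_graph_of.
- exact: psi_of_eq.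
- exact: phi_of_eq.
- exact: graph_of_eq.
Qed.

(** On a slot [graph_of U] vanishes, and the linear part is one of the four
    coefficients computed above. *)
Lemma residual_of_slot mu U V a b : (k < mu)%N -> wge k mu (U - V) ->
  (a + k * b = mu)%N -> slot a ->
  residual_of U a b - residual_of V a b = V a b - U a b.
Proof.
move=> k_mu dUV eqab sa; have graph0 W : graph_of W a b = 0 by rewrite /= sa.
rewrite (residual_ofB k_mu dUV eqab) (graph0 U) (graph0 V) subrr subr0 {graph0}.
have eqUV c d : slot c -> (c + k * d < mu)%N -> U c d = V c d.
  by move=> _; apply: wgeB_eq dUV.
have psi0 n : (k * n + k.-1 < mu)%N -> (psi_of U - psi_of V) n = 0.
  by move=> lt; rewrite coef_fpsD coef_fpsN (psi_of_eq eqUV) ?subrr.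
have phi0 n : (k * n < mu)%N -> (phi_of U - phi_of V) n = 0.
  by move=> lt; rewrite coef_fpsD coef_fpsN (phi_of_eq eqUV) ?subrr.
have w_k := wge_surface_w G_gt.
have w_lead := surface_w_lead G_gt.
have k_neq0 : k%:R != 0 :> R by rewrite pnatr_eq0 -lt0n.
have b_gt1 : a = 0%N -> (1 < b)%N.
  by move=> a0; rewrite -(ltn_pmul2l k_gt0) muln1; lia.
move: sa; rewrite /slot !inE => /or4P[] /eqP a_eq; rewrite a_eq in eqab b_gt1 *.
- rewrite (linear_part_0 _ k_gt1 w_k w_lead phi0) //.
  by move: b_gt1 => /(_ erefl); case: b eqab => [|[|b]] //= _ _; ring.
- rewrite (linear_part_k1 k_gt1 w_k w_lead psi0 phi0); last by lia.
  by case: b eqab {b_gt1} => [|b] /= eqab; [lia|field].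
- have eqmu : mu = (k * b.+1)%N by rewrite mulnS.
  rewrite (linear_part_k k_gt1 w_k w_lead psi0 phi0 (n := b.+1)) //.
  case: b eqab eqmu {b_gt1} => [|b] /= eqab eqmu; first by lia.
  have : (b.+2%:R : R) != 0 by rewrite pnatr_eq0.
  by move: (b.+2%:R : R) => c c_neq0; field.
have eqmu : mu = (k * b.+1 + k.-1)%N by rewrite mulnS; lia.
rewrite (linear_part_2k1 k_gt1 w_k w_lead psi0 phi0 (n := b.+1)) //=.
have : (b.+1%:R : R) != 0 by rewrite pnatr_eq0.
by move: (b.+1%:R : R) => c c_neq0; field; rewrite c_neq0.
Qed.

(** Once the slots agree in weight [mu] too, the linear part of the difference
    starts above weight [mu], and only the change of [graph_of] remains. *)
Lemma residual_of_normal mu U V a b : (k < mu)%N -> wge k mu (U - V) ->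
  (forall c d, slot c -> (c + k * d < mu.+1)%N -> U c d = V c d) ->
  (a + k * b = mu)%N -> ~~ slot a ->
  residual_of U a b - residual_of V a b = V a b - U a b.
Proof.
move=> k_mu dUV eqUV eqab sa; rewrite (residual_ofB k_mu dUV eqab).
rewrite (@wge_linear_part _ _ _ _ _ mu.+1) ?eqab //; first last.
- by move=> n lt; rewrite coef_fpsD coef_fpsN (phi_of_eq eqUV) ?subrr.
- by move=> n lt; rewrite coef_fpsD coef_fpsN (psi_of_eq eqUV) ?subrr.
- exact: wge_surface_w.
by rewrite /= (negbTE sa) eqab leqNgt k_mu sub0r opprB.
Qed.

Lemma residual_of_eq0 : exists U, residual_of U = 0.
Proof.
apply: (triangular_solution (k := k) (n := k) (s := slot)).
- by move=> U; apply: wge_residual => //; apply: weight_gt_graph_of.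
- by move=> U V a b k_ab dUV sa; exact: (residual_of_slot k_ab dUV erefl sa).
move=> U V a b k_ab dUV eqUV sa.
exact: (residual_of_normal k_ab dUV eqUV erefl sa).
Qed.

End Normalization.

Theorem proposition7p1 (R : realType) (k : nat) (hk : (2 < k)%N)
    (G : ps2 R) (hG : weight_gt k G) :
  exists (psi phi : fps R[i]) (G' : ps2 R),
    [/\ formal_transformation psi phi,
        takes_into k psi phi G G'
      & normal_form k G'].
Proof.
have [U resU] := residual_of_eq0 hk hG.
exists (psi_of k U), (phi_of k U), (graph_of k U); split.
- by split=> //=; rewrite addr0 oner_eq0.
- exact: residual_eq0.
- exact: normal_form_graph_of.
Qed.
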